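(* Let $\Gamma$ be a finite simplicial graph and let $F$ be a field. Set $V=H^1(A(\Gamma),F)$ and $W=H^2(A(\Gamma),F)$, and let $q\colon V\times V\to W$ be the cup product pairing. Then $\Gamma$ admits a Hamiltonian path if and only if the triple $(V,W,q)$ is Hamiltonian.
   Context: A finite simplicial graph is a finite undirected graph with no loops and no multiple edges (i.e. a simple graph), with vertex set $V(\Gamma)$ and edge set $E(\Gamma)$. The right-angled Artin group on $\Gamma$ is $A(\Gamma)=\langle V(\Gamma)\mid [v,w]=1 \text{ for all } \{v,w\}\in E(\Gamma)\rangle$. $H^*(A(\Gamma),F)$ denotes group cohomology with (trivial) coefficients in $F$. A Hamiltonian path in $\Gamma$ is a path that visits every vertex of $\Gamma$ exactly once. Let $V,W$ be vector spaces over a field $F$ with $V$ finite dimensional and let $q\colon V\times V\to W$ be a symmetric or anti-symmetric bilinear pairing. The triple $(V,W,q)$ is called Hamiltonian if for every basis $\{w_1,\ldots,w_n\}$ of $V$ there is a permutation $\sigma\in S_n$ such that $q(w_{\sigma(i)},w_{\sigma(i+1)})\neq 0$ for all $1\leq i<n$. *)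

(* Defs.v *)
From HB Require Import structures.
From mathcomp Require Import all_boot perm all_algebra.
From mathcomp Require Import boolp classical_sets functions.
From mathcomp Require Import ring.

Set Implicit Arguments.
Unset Strict Implicit.
Unset Printing Implicit Defensive.

Import GRing.Theory.
Local Open Scope ring_scope.
Local Open Scope quotient_scope.

(* Groups given by generators and relators. The letter (x, false) stands for  *)
(* the generator x and (x, true) for its inverse.                             *)

Definition word (X : Type) := seq (X * bool).

Definition inv_letter (X : Type) (l : X * bool) := (l.1, ~~ l.2).

Definition inv_word (X : Type) (u : word X) : word X :=
  rev (map (@inv_letter X) u).

Inductive word_eq (X : Type) (R : word X -> Prop) : word X -> word X -> Prop :=
| WordEqRefl u : word_eq R u u
| WordEqSym u v : word_eq R u v -> word_eq R v u
| WordEqTrans v u w : word_eq R u v -> word_eq R v w -> word_eq R u w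
| WordEqCancel u l v : word_eq R (u ++ [:: l; inv_letter l] ++ v) (u ++ v)
| WordEqRel u r v : R r -> word_eq R (u ++ r ++ v) (u ++ v).

Section Presented.
Variables (X : choiceType) (R : word X -> Prop).
Implicit Types u v w : word X.

Definition word_eqb u v : bool := `[< word_eq R u v >].

Fact word_eqb_equiv : equiv_class_of word_eqb.
Proof.
split=> [u|u v|v u w]; first exact/asboolP/WordEqRefl.
  by apply/asboolP/asboolP; apply: WordEqSym.
by move=> /asboolP uv /asboolP vw; apply/asboolP/(WordEqTrans uv).
Qed.
Canonical word_eqb_equiv_rel := EquivRelPack word_eqb_equiv.
Canonical word_eqb_encModRel := defaultEncModRel word_eqb.

Definition presented := {eq_quot word_eqb}.
HB.instance Definition _ : EqQuotient (word X) word_eqb presented :=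
  EqQuotient.on presented.
HB.instance Definition _ := Choice.on presented.

Definition presented_class u : presented := \pi_presented u.

Lemma presented_classP u v :
  presented_class u = presented_class v <-> word_eq R u v.
Proof.
split=> [/eqmodP/asboolP //|uv]; exact/eqmodP/asboolP.
Qed.

Lemma word_eq_ctx a b u v : word_eq R u v -> word_eq R (a ++ u ++ b) (a ++ v ++ b).
Proof.
elim=> {u v} [u|u v _ IH|v u w _ IH1 _ IH2|u l v|u r v Rr].
- exact: WordEqRefl.
- exact: WordEqSym.
- exact: WordEqTrans IH1 IH2.
- by have := WordEqCancel R (a ++ u) l (v ++ b); rewrite -!catA.
- by have := WordEqRel (a ++ u) (v ++ b) Rr; rewrite -!catA.
Qed.

Lemma word_eq_cat u u' v v' :
  word_eq R u u' -> word_eq R v v' -> word_eq R (u ++ v) (u' ++ v').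
Proof.
move=> uu' vv'; apply: (@WordEqTrans _ _ (u' ++ v)).
  exact: (@word_eq_ctx [::] v _ _ uu').
by have := @word_eq_ctx u' [::] _ _ vv'; rewrite !cats0.
Qed.

Lemma inv_letterK : involutive (@inv_letter X).
Proof. by case=> x b; rewrite /inv_letter /= negbK. Qed.

Lemma inv_wordK : involutive (@inv_word X).
Proof.
by move=> u; rewrite /inv_word map_rev revK -map_comp (eq_map inv_letterK) map_id.
Qed.

Lemma inv_word_cat u v : inv_word (u ++ v) = inv_word v ++ inv_word u.
Proof. by rewrite /inv_word map_cat rev_cat. Qed.

Lemma word_eq_invr u : word_eq R (u ++ inv_word u) [::].
Proof.
elim: u => [|l u IH]; first exact: WordEqRefl.
rewrite -cat1s inv_word_cat -catA (catA u).
apply: WordEqTrans (word_eq_ctx [:: l] (inv_word [:: l]) IH) _.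
exact: (WordEqCancel R [::] l [::]).
Qed.

Lemma word_eq_invl u : word_eq R (inv_word u ++ u) [::].
Proof. by have := word_eq_invr (inv_word u); rewrite inv_wordK. Qed.

Lemma word_eq_inv u v : word_eq R u v -> word_eq R (inv_word u) (inv_word v).
Proof.
move=> uv; apply: (@WordEqTrans _ _ (inv_word u ++ (v ++ inv_word v))).
  rewrite -[X in word_eq _ X]cats0; apply: word_eq_cat (WordEqRefl _ _) _.
  exact/WordEqSym/word_eq_invr.
rewrite catA -[X in word_eq _ _ X]cat0s; apply: word_eq_cat (WordEqRefl _ _).
apply: WordEqTrans (word_eq_invl u).
exact: word_eq_cat (WordEqRefl _ _) (WordEqSym uv).
Qed.

Definition presented_mul (x y : presented) : presented :=
  presented_class (repr x ++ repr y).
Definition presented_inv (x : presented) : presented :=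
  presented_class (inv_word (repr x)).

Lemma presented_classK (x : presented) : presented_class (repr x) = x.
Proof. exact: reprK. Qed.

Lemma word_eq_repr u : word_eq R (repr (presented_class u)) u.
Proof. exact/presented_classP/presented_classK. Qed.

Lemma presented_class_cat u v :
  presented_class (u ++ v) = presented_mul (presented_class u) (presented_class v).
Proof.
by apply/presented_classP/word_eq_cat; apply: WordEqSym; apply: word_eq_repr.
Qed.

Lemma presented_class_inv u :
  presented_class (inv_word u) = presented_inv (presented_class u).
Proof. by apply/presented_classP/word_eq_inv/WordEqSym/word_eq_repr. Qed.

Fact presented_mulA : associative presented_mul.
Proof.
move=> x y z; rewrite -[x]presented_classK -[y]presented_classK.
by rewrite -[z]presented_classK -!presented_class_cat catA.
Qed.

Fact presented_mul1 : left_id (presented_class [::]) presented_mul.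
Proof. by move=> x; rewrite -[x]presented_classK -presented_class_cat. Qed.

Fact presented_mulr1 : right_id (presented_class [::]) presented_mul.
Proof. by move=> x; rewrite -[x]presented_classK -presented_class_cat cats0. Qed.

Fact presented_mulV : left_inverse (presented_class [::]) presented_inv presented_mul.
Proof.
move=> x; rewrite -[x]presented_classK -presented_class_inv -presented_class_cat.
exact/presented_classP/word_eq_invl.
Qed.

Fact presented_mulrV : right_inverse (presented_class [::]) presented_inv presented_mul.
Proof.
move=> x; rewrite -[x]presented_classK -presented_class_inv -presented_class_cat.
exact/presented_classP/word_eq_invr.
Qed.

HB.instance Definition _ := isMonoid.Build presented
  presented_mulA presented_mul1 presented_mulr1.
HB.instance Definition _ := hasInv.Build presented presented_inv.
HB.instance Definition _ := Monoid_isGroup.Build presented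
  presented_mulV presented_mulrV.

Definition presented_gen (x : X) : presented := presented_class [:: (x, false)].

End Presented.

Section RAAG.
Variables (T : finType) (e : rel T).

Inductive raag_relator : word T -> Prop :=
| RaagCommutator v w : e v w ->
    raag_relator [:: (v, true); (w, true); (v, false); (w, false)].

Definition raag := presented raag_relator.
HB.instance Definition _ := Group.on raag.

Definition raag_gen (v : T) : raag := presented_gen raag_relator v.

End RAAG.

(* Group cohomology with trivial coefficients, from inhomogeneous cochains.   *)

Section Cohomology.
Variables (F : fieldType) (G : groupType).

Definition cochain n := n.-tuple G -> F^o.
HB.instance Definition _ n := GRing.Lmodule.on (cochain n).

(* For t = (t_0, ..., t_n), face 0 t drops t_0, face n.+1 t drops t_n, and    *)
(* for 0 < i <= n, face i t replaces t_(i-1), t_i by their product.           *)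
Definition face n (i : 'I_n.+2) (t : n.+1.-tuple G) : n.-tuple G :=
  [tuple if (j.+1 < i)%N then nth 1%g t j
         else if j.+1 == i :> nat then (nth 1%g t j * nth 1%g t j.+1)%g
         else nth 1%g t j.+1 | j < n].

Definition cobord n (f : cochain n) : cochain n.+1 :=
  fun t => \sum_(i < n.+2) (-1) ^+ i * f (face i t).

Definition cocycle n : {pred cochain n} := fun f => `[< cobord f = 0 >].

Definition coboundary n : {pred cochain n} :=
  match n return {pred cochain n} with
  | 0 => fun f => `[< f = 0 >]
  | m.+1 => fun f => `[< exists h : cochain m, f = cobord h >]
  end.

Lemma cobordP n a (f h : cochain n) :
  cobord (a *: f + h) = a *: cobord f + cobord h.
Proof.
apply/funext=> t; rewrite /cobord !fctE /GRing.scale /= mulr_sumr -big_split /=.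
by apply: eq_bigr => i _; rewrite mulrDr mulrCA.
Qed.

Lemma cobord0 n : cobord (0 : cochain n) = 0.
Proof.
by apply/funext=> t; rewrite /cobord big1 // => i _; rewrite mulr0.
Qed.

Fact cocycle_submod n : submod_closed (@cocycle n).
Proof.
split=> [|a f h /asboolP df /asboolP dh]; apply/asboolP; first exact: cobord0.
by rewrite cobordP df dh scaler0 addr0.
Qed.
HB.instance Definition _ n :=
  GRing.isSubmodClosed.Build F (cochain n) (@cocycle n) (@cocycle_submod n).

Fact coboundary_submod n : submod_closed (@coboundary n).
Proof.
case: n => [|n]; split=> [|a f h /asboolP]; rewrite /in_mem /=.
- exact/asboolP.
- by move=> -> /asboolP ->; apply/asboolP; rewrite scaler0 addr0.
- by apply/asboolP; exists 0; rewrite cobord0.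
- move=> [f' ->] /asboolP[h' ->]; apply/asboolP.
  by exists (a *: f' + h'); rewrite cobordP.
Qed.
HB.instance Definition _ n :=
  GRing.isSubmodClosed.Build F (cochain n) (@coboundary n) (@coboundary_submod n).

Definition cocycles n := {f : cochain n | f \in @cocycle n}.
HB.instance Definition _ n := SubChoice.on (cocycles n).
HB.instance Definition _ n := [SubChoice_isSubLmodule of cocycles n by <:].

(* H^n is Z^n / (B^n :&: Z^n); as B^n is contained in Z^n, this is Z^n / B^n.  *)
Definition cocycle_coboundary n : {pred cocycles n} :=
  fun z => \val z \in @coboundary n.

Fact cocycle_coboundary_zmod n : zmod_closed (@cocycle_coboundary n).
Proof.
split=> [|x y]; rewrite /in_mem /= /cocycle_coboundary; first exact: rpred0.
by move=> Bx By; rewrite rpredB.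
Qed.
HB.instance Definition _ n := GRing.isZmodClosed.Build (cocycles n)
  (@cocycle_coboundary n) (@cocycle_coboundary_zmod n).

Definition cohomology n := Quotient.quot (@cocycle_coboundary n).
HB.instance Definition _ n := ZmodQuotient.on (cohomology n).

Definition cohomology_class n (z : cocycles n) : cohomology n :=
  \pi_(cohomology n) z.

Lemma cohomology_classP n (x y : cocycles n) :
  cohomology_class x = cohomology_class y <->
  \val x - \val y \in @coboundary n.
Proof.
split=> [/eqquotP|xy]; rewrite ?/Quotient.equiv //.
exact/eqquotP.
Qed.

Lemma cohomology_classK n (a : cohomology n) : cohomology_class (repr a) = a.
Proof. exact: reprK. Qed.

Lemma cohomology_classN n (x : cocycles n) :
  cohomology_class (- x) = - cohomology_class x.
Proof. by rewrite /cohomology_class !piE. Qed.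

Lemma cohomology_classD n (x y : cocycles n) :
  cohomology_class (x + y) = cohomology_class x + cohomology_class y.
Proof. by rewrite /cohomology_class !piE. Qed.

Definition cohomology_scale n (c : F) (a : cohomology n) : cohomology n :=
  cohomology_class (c *: repr a).

Lemma cohomology_classZ_subproof n c (x : cocycles n) :
  cohomology_scale c (cohomology_class x) = cohomology_class (c *: x).
Proof.
apply/cohomology_classP.
rewrite (_ : _ - _ = c *: (\val (repr (cohomology_class x)) - \val x)).
  by apply: rpredZ; apply/cohomology_classP; rewrite cohomology_classK.
by rewrite scalerBr.
Qed.

Fact cohomology_scaleA n a b (v : cohomology n) :
  cohomology_scale a (cohomology_scale b v) = cohomology_scale (a * b) v.
Proof.
rewrite -[v]cohomology_classK !cohomology_classZ_subproof.
by rewrite scalerA.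
Qed.

Fact cohomology_scale1 n : left_id 1 (@cohomology_scale n).
Proof.
by move=> v; rewrite -[v]cohomology_classK cohomology_classZ_subproof scale1r.
Qed.

Fact cohomology_scaleDr n : right_distributive (@cohomology_scale n) +%R.
Proof.
move=> a u v; rewrite -[u]cohomology_classK -[v]cohomology_classK.
by rewrite -cohomology_classD !cohomology_classZ_subproof scalerDr cohomology_classD.
Qed.

Fact cohomology_scaleDl n (v : cohomology n) :
  {morph @cohomology_scale n ^~ v : a b / a + b}.
Proof.
move=> a b; rewrite -[v]cohomology_classK !cohomology_classZ_subproof.
by rewrite scalerDl cohomology_classD.
Qed.

HB.instance Definition _ n := GRing.Zmodule_isLmodule.Build F (cohomology n)
  (@cohomology_scaleA n) (@cohomology_scale1 n) (@cohomology_scaleDr n)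
  (@cohomology_scaleDl n).

Lemma cohomology_classZ n c (x : cocycles n) :
  cohomology_class (c *: x) = c *: cohomology_class x.
Proof. by rewrite -cohomology_classZ_subproof. Qed.

(* No sign is put in the cup product. The other usual convention, with the    *)
(* factor (-1)^(p q), only replaces the pairing of degree (1, 1) by its       *)
(* opposite.                                                                  *)
Definition cochain_cup p q (f : cochain p) (h : cochain q) : cochain (p + q) :=
  fun t => f [tuple nth 1%g t i | i < p] * h [tuple nth 1%g t (p + j)%N | j < q].

Lemma tuple1E (H : 'I_1 -> G) : [tuple H i | i < 1] = [tuple H ord0].
Proof. by apply: eq_from_tnth => i; rewrite tnth_mktuple !ord1. Qed.

Lemma tuple2E (H : 'I_2 -> G) : [tuple H i | i < 2] = [tuple H ord0; H (lift ord0 ord0)].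
Proof.
apply: eq_from_tnth => i; rewrite tnth_mktuple.
by case: (unliftP ord0 i) => [j|] ->; rewrite ?ord1.
Qed.

Lemma cobord0E (f : cochain 0) t : cobord f t = 0.
Proof.
rewrite /cobord !big_ord_recl big_ord0 /= (tuple0 (face _ _)) (tuple0 (face _ t)).
by rewrite expr0 expr1 mul1r mulN1r addr0 subrr.
Qed.

Lemma cobord1E (f : cochain 1) x y :
  cobord f [tuple x; y] = f [tuple y] - f [tuple (x * y)%g] + f [tuple x].
Proof.
rewrite /cobord !big_ord_recl big_ord0 /face !tuple1E /=.
by rewrite !expr0 expr1 sqrrN expr1n !mul1r mulN1r addr0 addrA.
Qed.

Lemma cobord2E (f : cochain 2) x y z :
  cobord f [tuple x; y; z] = f [tuple y; z] - f [tuple (x * y)%g; z]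
    + f [tuple x; (y * z)%g] - f [tuple x; y].
Proof.
rewrite /cobord !big_ord_recl big_ord0 /face !tuple2E /=.
by rewrite /bump /= !exprS !expr0 !mulr1 !mulN1r !opprK !mul1r addr0 mulN1r !addrA.
Qed.

Lemma cochain_cup11E (f h : cochain 1) x y :
  cochain_cup f h [tuple x; y] = f [tuple x] * h [tuple y].
Proof. by rewrite /cochain_cup !tuple1E. Qed.

Lemma cocycle1P (f : cochain 1) :
  reflect (forall x y, f [tuple (x * y)%g] = f [tuple x] + f [tuple y])
          (f \in @cocycle 1).
Proof.
apply: (iffP idP) => [/asboolP df x y|fM].
  have := cobord1E f x y; rewrite df => /esym/eqP.
  by rewrite addrAC subr_eq0 addrC => /eqP.
apply/asboolP/funext => t; case/tupleP: t => x t; case/tupleP: t => y t.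
rewrite (tuple0 t) /= (_ : [tuple of _] = [tuple x; y]); last exact/val_inj.
by rewrite cobord1E fM addrAC [X in X - _]addrC subrr.
Qed.

Lemma coboundary1E (f : cochain 1) : f \in @coboundary 1 -> f = 0.
Proof.
by move=> /asboolP[h ->]; apply/funext => t; rewrite cobord0E.
Qed.

Fact cochain_cup_cocycle (f h : cocycles 1) :
  (cochain_cup (\val f) (\val h) : cochain 2) \in @cocycle 2.
Proof.
have /cocycle1P fM := valP f; have /cocycle1P hM := valP h.
apply/asboolP/funext => t; case/tupleP: t => x t; case/tupleP: t => y t.
case/tupleP: t => z t.
rewrite (tuple0 t) (_ : [tuple of _] = [tuple x; y; z]); last exact/val_inj.
rewrite cobord2E !cochain_cup11E fM hM.
have E (a b c d : F) : a * c - (b + a) * c + b * (d + c) - b * d = 0 by ring.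
exact: E.
Qed.

Definition cocycle_cup (f h : cocycles 1) : cocycles 2 :=
  Sub (cochain_cup (\val f) (\val h)) (cochain_cup_cocycle f h).

Definition cup (a b : cohomology 1) : cohomology 2 :=
  cohomology_class (cocycle_cup (repr a) (repr b)).

Lemma cohomology1_reprK (z : cocycles 1) : repr (cohomology_class z) = z.
Proof.
apply/val_inj/eqP; rewrite -subr_eq0; apply/eqP/coboundary1E.
exact/cohomology_classP/cohomology_classK.
Qed.

Lemma cup_class (f h : cocycles 1) :
  cup (cohomology_class f) (cohomology_class h) = cohomology_class (cocycle_cup f h).
Proof. by rewrite /cup !cohomology1_reprK. Qed.

Fact cup_bilinear : bilinear_for *:%R *:%R cup.
Proof.
split=> [b c a a'|a c b b'].
  rewrite -[a]cohomology_classK -[a']cohomology_classK -[b]cohomology_classK.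
  rewrite -cohomology_classZ -cohomology_classD !cup_class /=.
  rewrite -cohomology_classZ -cohomology_classD; congr cohomology_class.
  apply/val_inj/funext => t; rewrite /= /cochain_cup /= !fctE.
  by rewrite mulrDl -mulrA.
rewrite -[a]cohomology_classK -[b']cohomology_classK -[b]cohomology_classK.
rewrite -cohomology_classZ -cohomology_classD !cup_class. rewrite /=.
rewrite -cohomology_classZ -cohomology_classD; congr cohomology_class.
apply/val_inj/funext => t; rewrite /= /cochain_cup /= !fctE.
by rewrite mulrDr mulrCA.
Qed.
HB.instance Definition _ :=
  bilinear_isBilinear.Build F (cohomology 1) (cohomology 1) (cohomology 2)
    *:%R *:%R cup cup_bilinear.

Lemma cup_anti (a b : cohomology 1) : cup a b = - cup b a.
Proof.
rewrite -[a]cohomology_classK -[b]cohomology_classK !cup_class.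
move: (repr a) (repr b) => f h; rewrite -cohomology_classN.
apply/cohomology_classP/asboolP.
exists (fun t => - (\val f t * \val h t)).
have /cocycle1P fM := valP f; have /cocycle1P hM := valP h.
apply/funext => t; case/tupleP: t => x t; case/tupleP: t => y t.
rewrite (tuple0 t) /= (_ : [tuple of _] = [tuple x; y]); last exact/val_inj.
rewrite cobord1E /= !fctE !cochain_cup11E fM hM.
have E (a1 a2 b1 b2 : F) :
  a1 * b2 - (- (b1 * a2)) = - (a2 * b2) - - ((a1 + a2) * (b1 + b2)) - a1 * b1.
  by ring.
exact: E.
Qed.

End Cohomology.

(* The value at v of a class in H^1(A(Gamma), F) = Hom(A(Gamma), F), for v a  *)
(* vertex, gives coordinates that make this space a vectType.                 *)

Section RaagH1.
Variables (F : fieldType) (T : finType) (e : rel T).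
Implicit Types (c : 'rV[F]_#|T|) (u v : word T).

Definition letter_val c (l : T * bool) : F := (-1) ^+ l.2 * c ord0 (enum_rank l.1).

Definition word_val c u : F := \sum_(l <- u) letter_val c l.

Lemma word_val_cat c u v : word_val c (u ++ v) = word_val c u + word_val c v.
Proof. by rewrite /word_val big_cat. Qed.

Lemma word_val_eq c u v : word_eq (raag_relator e) u v -> word_val c u = word_val c v.
Proof.
elim=> {u v} [//|//|u v w _ -> //|u l v|u r v [x y _]]; rewrite !word_val_cat;
  congr (_ + _); rewrite /word_val !(big_cons, big_nil) /letter_val /=.
  by case: l => x [] /=; rewrite expr0 expr1; ring.
by rewrite expr0 expr1; ring.
Qed.

Definition raag_cochain c : cochain F (raag e) 1 :=
  fun t => word_val c (repr (thead t)).

Fact raag_cochain_cocycle c : raag_cochain c \in @cocycle F (raag e) 1.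
Proof.
apply/cocycle1P => x y; rewrite /raag_cochain /thead !(tnth_nth 1%g) /=.
by rewrite (word_val_eq c (word_eq_repr _ _)) word_val_cat.
Qed.

Definition raag_cocycle c : cocycles F (raag e) 1 :=
  Sub (raag_cochain c) (raag_cochain_cocycle c).

Definition raag_coord (a : cohomology F (raag e) 1) : 'rV[F]_#|T| :=
  \row_i (\val (repr a) [tuple raag_gen e (enum_val i)] : F).

Fact raag_coord_linear : linear raag_coord.
Proof.
move=> k a b; apply/rowP => i; rewrite !mxE.
rewrite -[a]cohomology_classK -[b]cohomology_classK -cohomology_classZ.
by rewrite -cohomology_classD !cohomology1_reprK /= !fctE.
Qed.

Lemma raag_cocycle_val (z : cocycles F (raag e) 1) u :
  \val z [tuple presented_class (raag_relator e) u : raag e] =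
  word_val (raag_coord (cohomology_class z)) u.
Proof.
have /cocycle1P zM := valP z; have z1 : \val z [tuple 1%g] = 0.
  have /eqP := zM 1%g 1%g; rewrite mulg1 -subr_eq0 opprD addrA subrr add0r.
  by rewrite oppr_eq0 => /eqP.
elim: u => [|[x b] u IH]; first by rewrite /word_val big_nil -z1.
rewrite -cat1s presented_class_cat zM word_val_cat IH; congr (_ + _).
rewrite /word_val big_seq1 /letter_val /= mxE cohomology1_reprK enum_rankK.
case: b; rewrite ?expr0 ?mul1r // expr1 mulN1r; apply/eqP.
rewrite -addr_eq0 -zM -z1 -(mulVg (raag_gen e x)); apply/eqP.
congr (\val z [tuple (_ * _)%g]).
exact: (presented_class_inv (raag_relator e) [:: (x, false)]).
Qed.

Fact raag_coord_bij : bijective raag_coord.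
Proof.
exists (fun c => cohomology_class (raag_cocycle c)) => [a|c].
  rewrite -[RHS]cohomology_classK; congr cohomology_class.
  apply/val_inj/funext => t; case/tupleP: t => x t; rewrite (tuple0 t) /=.
  rewrite (_ : [tuple of _] = [tuple x]); last exact/val_inj.
  rewrite -[in RHS](presented_classK x) raag_cocycle_val cohomology_classK.
  by rewrite /raag_cochain /thead (tnth_nth 1%g).
apply/rowP => i; rewrite mxE cohomology1_reprK /= /raag_cochain /thead (tnth_nth 1%g) /=.
rewrite (word_val_eq c (word_eq_repr _ _)) /word_val big_seq1 /letter_val /=.
by rewrite expr0 mul1r enum_valK.
Qed.

HB.instance Definition _ := Lmodule_hasFinDim.Build F (cohomology F (raag e) 1)
  (exist2 _ _ raag_coord raag_coord_linear raag_coord_bij).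

End RaagH1.

Section Hamiltonian.
Variables (F : fieldType) (V : vectType F) (W : lmodType F).

Record pairing := Pairing {
  pairing_form :> {bilinear V -> V -> W};
  pairing_sym : (forall u v, pairing_form u v = pairing_form v u) \/
                (forall u v, pairing_form u v = - pairing_form v u)
}.

Definition hamiltonian (q : pairing) : Prop :=
  forall (n : nat) (w : n.-tuple V), basis_of fullv w ->
  exists s : 'S_n, forall i j : 'I_n, j = i.+1 :> nat ->
    q (tnth w (s i)) (tnth w (s j)) != 0.

End Hamiltonian.

Definition raag_cup (F : fieldType) (T : finType) (e : rel T) :
    pairing (cohomology F (raag e) 1) (cohomology F (raag e) 2) :=
  @Pairing F (cohomology F (raag e) 1) (cohomology F (raag e) 2)
    (@cup F (raag e)) (or_intror (@cup_anti F (raag e))).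

(* The empty sequence is a Hamiltonian path of the graph with no vertices.    *)
Definition has_hamiltonian_path (T : finType) (e : rel T) : Prop :=
  exists p : seq T, [/\ sorted e p, uniq p & forall v, v \in p].

(* Main.v *)
From HB Require Import structures.
Require Import Defs.
From mathcomp Require Import all_boot all_algebra.
From mathcomp Require Import perm boolp ring.

Set Implicit Arguments.
Unset Strict Implicit.
Unset Printing Implicit Defensive.

Import GRing.Theory.
Local Open Scope ring_scope.

(** A class in degree one is a homomorphism from the group to the field, hence
    a vector of coordinates indexed by the vertices.  The cup product of two
    classes vanishes exactly when all the 2 x 2 minors of their coordinate
    vectors on pairs of columns forming an edge vanish ([cup_eq0P]): a
    coboundary takes the same value at (x, y) and at (y, x) when x and y
    commute, and conversely the vanishing of the minors is what makes an
    explicit primitive, defined on words, invariant under the relations.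

    On the basis dual to the vertices, the cup product of two classes can thus
    be nonzero only if the two vertices are adjacent, so a good ordering of this
    basis is a Hamiltonian path.

    For the other direction, more is true than asked: the rows of any invertible
    matrix whose columns are the vertices can be matched with the vertices in
    such a way that any two adjacent vertices receive rows with a nonzero minor
    on some edge ([spanning_edge_minors]).  A Hamiltonian path is then carried
    to a good ordering of the basis.  The matching comes from a nonzero term
    of the expansion of the determinant: each vertex x receives a row whose
    entry at x is nonzero.  Suppose that it fails, that is, that x and y are
    adjacent while the rows a and b assigned to them have all edge minors zero.
    Then a and b are nonzero at both x and y, and proportional on the
    set S of vertices z where neither vanishes and a_z : b_z = a_x : b_x.
    Since the edge minors vanish, S has no edge to the rest of the support of a,
    nor to the rest of the support of b.  As a and b are linearly independent,
    one of them has a nonzero entry outside S; it is the sum of its parts on S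
    and off S, and by linearity of the determinant one of these parts
    can replace it and leave the matrix invertible.  The replacement has more
    zeros, and creates no new nonzero edge minor between rows because no
    edge joins the two parts; so induction on the number of nonzero entries
    concludes. *)

(** * Edge minors of an invertible matrix *)

Section EdgeMinors.
Variables (F : fieldType) (n : nat) (adj : rel 'I_n).
Implicit Types (a b : 'rV[F]_n) (A : 'M[F]_n) (S : pred 'I_n) (r i j : 'I_n).

Definition edge_minor a b : bool :=
  [exists k, exists l, adj k l && (a 0 k * b 0 l != a 0 l * b 0 k)].

Lemma edge_minorP a b :
  reflect (exists k l, adj k l /\ a 0 k * b 0 l != a 0 l * b 0 k)
          (edge_minor a b).
Proof.
apply: (iffP existsP) => [[k /existsP[l /andP[kl ab]]]|[k [l [kl ab]]]].
  by exists k, l.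
by exists k; apply/existsP; exists l; rewrite kl.
Qed.

Lemma edge_minorC a b : edge_minor a b = edge_minor b a.
Proof.
apply/edge_minorP/edge_minorP => -[k [l [kl ab]]]; exists k, l; split => //;
  by rewrite eq_sym [X in X != _]mulrC [X in _ != X]mulrC.
Qed.

Definition mask_row r S A : 'M[F]_n :=
  \matrix_(i, j) if (i == r) && ~~ S j then 0 else A i j.

Lemma det_mask_row r S A :
  \det A = \det (mask_row r S A) + \det (mask_row r (predC S) A).
Proof.
rewrite (@determinant_multilinear _ _ A (mask_row r S A)
  (mask_row r (predC S) A) r 1 1) ?mul1r //.
- apply/rowP => j; rewrite !mxE eqxx /= !mul1r.
  by case: (S j); rewrite ?addr0 ?add0r.
- by apply/matrixP => i j; rewrite !mxE eq_sym (negPf (neq_lift _ _)).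
- by apply/matrixP => i j; rewrite !mxE eq_sym (negPf (neq_lift _ _)).
Qed.

(** No edge between S and its complement has both ends in the support of a; S
    is thus, on that support, a union of connected components. *)
Definition separates S a :=
  forall k l, adj k l -> S k != S l -> a 0 k * a 0 l = 0.

Lemma separatesC S a : separates S a -> separates (predC S) a.
Proof.
by move=> sep k l kl Skl; apply: sep kl _; move: Skl; rewrite /=; case: (S k) (S l) => [] [].
Qed.

(** Across an edge leaving S, one of the two entries of the masked row was
    already zero.  So either masking leaves the minor unchanged, or it makes the
    row vanish at both ends. *)
Lemma edge_minor_mask r S A i j : separates S (row r A) -> i != j ->
  edge_minor (row i (mask_row r S A)) (row j (mask_row r S A)) ->
  edge_minor (row i A) (row j A).
Proof.
move=> sep; wlog jr : i j / j != r => [wl|] ij.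
  have [jr|/wl] := eqVneq j r; last exact.
  rewrite edge_minorC (edge_minorC (row i A)).
  by apply: wl; rewrite ?[j == i]eq_sym // -jr.
case/edge_minorP => k [l [kl]]; rewrite !mxE (negPf jr) /= => min.
apply/edge_minorP; exists k, l; split=> //; rewrite !mxE.
move: min; have [->/=|//] := eqVneq i r.
have := sep k l kl; rewrite !mxE.
case: (S k) (S l) => [] [] //= => [/(_ isT)|/(_ isT)|_]; last first.
- by rewrite !mul0r eqxx.
- move=> /eqP; rewrite mulf_eq0 => /orP[]/eqP-> //.
  by rewrite !mul0r eqxx.
- move=> /eqP; rewrite mulf_eq0 => /orP[]/eqP-> //.
  by rewrite !mul0r eqxx.
Qed.

Definition nonzeros A := #|[set ij : 'I_n * 'I_n | A ij.1 ij.2 != 0]|.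

(** The measure on which [spanning_edge_minors] is proved by induction. *)
Lemma nonzeros_mask r S A k :
  ~~ S k -> A r k != 0 -> (nonzeros (mask_row r S A) < nonzeros A)%N.
Proof.
move=> Sk Ark; apply: proper_card; apply/properP; split.
  apply/subsetP => -[i j]; rewrite !inE !mxE /=.
  by case: ifP => //; rewrite eqxx.
by exists (r, k); rewrite inE ?mxE /= ?eqxx ?Sk //= eqxx.
Qed.

Lemma det_neq0_transversal A :
  \det A != 0 -> exists s : 'S_n, forall k, A (s k) k != 0.
Proof.
rewrite -det_tr; apply: contra_neqP => noS.
rewrite /determinant big1 // => s _.
have /forallPn[k] : ~~ [forall k, A (s k) k != 0].
  by apply/forallP => sA; apply: noS; exists s.
rewrite negbK => /eqP Ak.
by rewrite (bigD1 k) //= mxE Ak mul0r mulr0.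
Qed.


(** Up to the factor d / c, row i can be replaced by row j, which gives two
    equal rows. *)
Lemma det_eq0_dep A i j (c d : F) : i != j -> c != 0 ->
  (forall k, c * A i k = d * A j k) -> \det A = 0.
Proof.
move=> ij c0 dep; apply: (mulfI c0); rewrite mulr0.
pose B : 'M[F]_n := \matrix_(i', k) if i' == i then A j k else A i' k.
rewrite (@determinant_multilinear _ _ A B B i (d / c) 0).
- rewrite mul0r addr0 (@determinant_alternate _ _ B i j ij) ?mulr0 // => k.
  by rewrite !mxE eqxx; case: eqP.
- apply/rowP => k; rewrite !mxE eqxx mul0r addr0; apply: (mulfI c0).
  by rewrite dep; field.
- by apply/matrixP => i' k; rewrite !mxE eq_sym (negPf (neq_lift _ _)).
- by apply/matrixP => i' k; rewrite !mxE eq_sym (negPf (neq_lift _ _)).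
Qed.

Hypotheses (adj_sym : symmetric adj) (adj_irr : irreflexive adj).

(** The set along which a matrix is cut when two of its rows a and b violate the
    conclusion of [spanning_edge_minors]: where both are nonzero, in the
    same ratio as at x. *)
Definition proportional_locus a b x : pred 'I_n :=
  fun z => [&& a 0 z != 0, b 0 z != 0 & a 0 z * b 0 x == a 0 x * b 0 z].

Lemma proportional_locusC a b x :
  proportional_locus a b x =1 proportional_locus b a x.
Proof.
move=> z; rewrite /proportional_locus andbCA; do 2!congr (_ && _).
by rewrite eq_sym [a 0 x * _]mulrC [a 0 z * _]mulrC.
Qed.

(** A vanishing minor at an edge that leaves from a point where a and b are both
    nonzero propagates the ratio: at the other end, a and b either both vanish,
    or are in the same ratio. *)
Lemma separates_proportional_locus a b x : ~~ edge_minor a b ->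
  a 0 x != 0 -> b 0 x != 0 -> separates (proportional_locus a b x) a.
Proof.
move=> noM ax bx; suff sepS k l : adj k l -> proportional_locus a b x k ->
    ~~ proportional_locus a b x l -> a 0 l = 0.
  move=> k l kl; case Sk: (proportional_locus _ _ _ k);
    case Sl: (proportional_locus _ _ _ l) => // _.
    by rewrite (sepS _ _ kl Sk) ?Sl ?mulr0.
  by rewrite [a 0 k](sepS l) ?Sk ?mul0r // adj_sym.
move=> kl /and3P[ak bk /eqP kx]; apply: contraNeq => al.
have min : a 0 k * b 0 l = a 0 l * b 0 k.
  by apply: contraNeq noM => ab; apply/edge_minorP; exists k, l.
apply/and3P; split=> //.
  apply: contra_eq_neq min => ->; rewrite mulr0 eq_sym.
  exact: mulf_neq0.
apply/eqP/(mulfI (mulf_neq0 ak bk)).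
transitivity (a 0 k * b 0 x * (a 0 l * b 0 k)); first by ring.
by rewrite kx -min; ring.
Qed.

(** In graph terms, the graph on the rows that joins two rows when they have a
    nonzero edge minor contains a spanning copy of the graph on the columns. *)
Theorem spanning_edge_minors A : \det A != 0 ->
  exists s : 'S_n, forall x y, adj x y ->
    edge_minor (row (s x) A) (row (s y) A).
Proof.
have [N] := ubnP (nonzeros A); elim: N A => // N IH A leN detA.
have [s sA] := det_neq0_transversal detA.
have [/forallP sP|/forallPn[x /forallPn[y]]] := boolP
  [forall x, forall y, adj x y ==> edge_minor (row (s x) A) (row (s y) A)].
  by exists s => x y xy; have /forallP/(_ y)/implyP := sP x; apply.
rewrite negb_imply => /andP[xy noM].
have sxy : s x != s y.
  by apply: contraTneq xy => /perm_inj ->; rewrite adj_irr.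
(* A row r cut nontrivially by a separating set S: the parts of r on S and off
   S both have fewer nonzero entries (r is nonzero at k off S and at x in S),
   and one of the two keeps the determinant nonzero. *)
have split_row r S k : separates S (row r A) -> S x -> A r x != 0 ->
    ~~ S k -> A r k != 0 -> exists s : 'S_n, forall x y, adj x y ->
    edge_minor (row (s x) A) (row (s y) A).
  move=> sep Sx Arx Sk Ark.
  suff [S' [sep' [k' [S'k' Ark']] detA']] : exists S', [/\ separates S' (row r A),
      exists k', ~~ S' k' /\ A r k' != 0 & \det (mask_row r S' A) != 0].
    have [|s' s'P] := IH _ _ detA'.
      exact: leq_trans (nonzeros_mask S'k' Ark') _.
    exists s' => u v uv; apply: edge_minor_mask sep' _ (s'P u v uv).
    by rewrite (inj_eq perm_inj); apply: contraTneq uv => ->; rewrite adj_irr.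
  have [d0|d0] := eqVneq (\det (mask_row r S A)) 0; last first.
    by exists S; split=> //; exists k.
  exists (predC S); split; first exact: separatesC.
    by exists x; rewrite /= Sx.
  by move: detA; rewrite (det_mask_row r S) d0 add0r.
(* All four entries at columns x and y are nonzero, since s is a transversal. *)
have Axy : A (s x) x * A (s y) y = A (s x) y * A (s y) x.
  apply: contraNeq noM => ab; apply/edge_minorP; exists x, y.
  by rewrite !mxE.
have /andP[_ Ayx] : (A (s x) y != 0) && (A (s y) x != 0).
  by rewrite -negb_or -mulf_eq0 -Axy mulf_neq0.
pose a := row (s x) A; pose b := row (s y) A.
have ax : a 0 x != 0 by rewrite mxE.
have bx : b 0 x != 0 by rewrite mxE.
pose S := proportional_locus a b x.
have Sx : S x by apply/and3P.
have sepa : separates S a by exact: separates_proportional_locus.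
have sepb : separates S b.
  move=> k l kl; rewrite /S !(proportional_locusC a).
  by apply: separates_proportional_locus => //; rewrite edge_minorC.
have [/existsP[k /andP[Sk Ak]]|/existsPn Sa] :=
  boolP [exists k, ~~ S k && (A (s x) k != 0)].
  exact: (split_row (s x) S k).
have [/existsP[k /andP[Sk Ak]]|/existsPn Sb] :=
  boolP [exists k, ~~ S k && (A (s y) k != 0)].
  exact: (split_row (s y) S k).
(* Both rows are now supported in S, hence proportional. *)
case/negP: detA; apply/eqP/(det_eq0_dep sxy Ayx (d := A (s x) x)) => k.
have [/and3P[_ _ /eqP]|Sk] := boolP (S k).
  by rewrite !mxE mulrC.
have := Sa k; rewrite Sk /= negbK => /eqP ->.
by have := Sb k; rewrite Sk /= negbK => /eqP ->; rewrite !mulr0.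
Qed.

End EdgeMinors.

(** * The cup product in coordinates *)

Section CupOnCoordinates.
Variables (F : fieldType) (T : finType) (e : rel T).
Implicit Types (c d : 'rV[F]_#|T|) (u v : word T).

Lemma raag_gen_commute x y : e x y ->
  (raag_gen e x * raag_gen e y = raag_gen e y * raag_gen e x)%g.
Proof.
move=> xy; suff : ((raag_gen e x)^-1 * ((raag_gen e y)^-1 *
    (raag_gen e x * raag_gen e y)) = 1)%g.
  by move=> /(canRL (mulVKg _)) /(canRL (mulVKg _)); rewrite mulg1.
have inv z : (raag_gen e z)^-1%g =
    presented_class (raag_relator e) [:: (z, true)] :> raag e.
  exact/esym/(presented_class_inv _ [:: (z, false)]).
rewrite !inv; transitivity (presented_class (raag_relator e)
   ([:: (x, true)] ++ [:: (y, true)] ++ [:: (x, false)] ++ [:: (y, false)]) : raag e).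
  by rewrite 3!presented_class_cat.
apply/presented_classP; exact: (WordEqRel [::] [::] (RaagCommutator xy)).
Qed.

(** The value on inverse letters is forced by the requirement that the primitive
    vanish on a letter followed by its inverse. *)
Definition letter_primitive c d (l : T * bool) : F :=
  if l.2 then - (c ord0 (enum_rank l.1) * d ord0 (enum_rank l.1)) else 0.

(** With [letter_primitive] on single letters, this is minus the sum of c(l) d(l')
    over the pairs of letters l occurring before l' in the word.  It is the
    upper right entry of a product of unitriangular 3 x 3 matrices, one for each
    letter l, with - c(l) and d(l) above the diagonal. *)
Fixpoint cup_primitive c d u : F :=
  if u is l :: u' then
    letter_primitive c d l + cup_primitive c d u' - letter_val c l * word_val d u'
  else 0.

Lemma cup_primitive_cat c d u v :
  cup_primitive c d (u ++ v) =
  cup_primitive c d u + cup_primitive c d v - word_val c u * word_val d v.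
Proof.
elim: u => [|l u IH] /=; first by rewrite /word_val big_nil mul0r subr0 add0r.
have -> : word_val c (l :: u) = letter_val c l + word_val c u.
  by rewrite /word_val big_cons.
by rewrite IH word_val_cat; ring.
Qed.

Definition edge_parallel c d := forall x y, e x y ->
  c ord0 (enum_rank x) * d ord0 (enum_rank y) =
  c ord0 (enum_rank y) * d ord0 (enum_rank x).

(** On the commutator relator of x and y the primitive is the minor
    c_x d_y - c_y d_x; since c and d vanish on relators, inserting a relator
    changes the primitive by this value only. *)
Lemma cup_primitive_eq c d u v : edge_parallel c d ->
  word_eq (raag_relator e) u v -> cup_primitive c d u = cup_primitive c d v.
Proof.
move=> cd; have ins r (w w' : word T) :
    word_val c r = 0 -> word_val d r = 0 -> cup_primitive c d r = 0 ->
    cup_primitive c d (w ++ r ++ w') = cup_primitive c d (w ++ w').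
  by move=> c0 d0 p0; rewrite !cup_primitive_cat !word_val_cat c0 d0 p0; ring.
elim=> {u v} [//|//|u v w _ -> //|u l v|u r v rel_r].
  apply: ins; case: l => x [];
    rewrite /= /word_val ?(big_cons, big_nil) /letter_primitive /letter_val /=;
    rewrite ?(expr0, expr1); ring.
have r0 c' : word_val c' r = 0.
  have /(word_val_eq c') := WordEqRel [::] [::] rel_r.
  by rewrite /= cats0 [in RHS]/word_val big_nil.
apply: ins => //; case: rel_r => x y xy.
rewrite /= /word_val !(big_cons, big_nil) /letter_primitive /letter_val /=.
rewrite !(expr0, expr1); have := cd x y xy.
move: (c _ _) (d _ _) (c _ _) (d _ _) => cx dy cy dx E.
transitivity (cx * dy - cy * dx); first by ring.
by rewrite E subrr.
Qed.

Lemma raag_cocycleK c : raag_coord (cohomology_class (raag_cocycle e c)) = c.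
Proof.
apply/rowP => i; rewrite mxE cohomology1_reprK /= /raag_cochain /thead (tnth_nth 1%g) /=.
rewrite (word_val_eq c (word_eq_repr _ _)) /word_val big_seq1 /letter_val /=.
by rewrite expr0 mul1r enum_valK.
Qed.

Lemma raag_cocycle_val_repr (z : cocycles F (raag e) 1) (x : raag e) :
  \val z [tuple x] = word_val (raag_coord (cohomology_class z)) (repr x).
Proof. by rewrite -raag_cocycle_val presented_classK. Qed.

(** A coboundary h(y) - h(x y) + h(x) is symmetric at commuting x and y, which
    gives the minors; the converse is the primitive [cup_primitive]. *)
Theorem cup_eq0P (a b : cohomology F (raag e) 1) :
  cup a b = 0 <-> edge_parallel (raag_coord a) (raag_coord b).
Proof.
rewrite -[a]cohomology_classK -[b]cohomology_classK cup_class.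
move: (repr a) (repr b) => {a b} f g.
have -> : (0 : cohomology F (raag e) 2) = cohomology_class 0.
  by rewrite /cohomology_class !piE.
split=> [/cohomology_classP/asboolP[h]|par].
  rewrite subr0 => fg x y xy.
  rewrite !mxE !cohomology1_reprK !enum_rankK -!cochain_cup11E.
  have {}fg g1 g2 :
      cochain_cup (\val f) (\val g) [tuple g1; g2] = cobord h [tuple g1; g2].
    by rewrite -fg.
  rewrite !(fg) !cobord1E raag_gen_commute //.
  by ring.
apply/cohomology_classP/asboolP; rewrite subr0 /=.
exists (fun t => cup_primitive (raag_coord (cohomology_class f))
                  (raag_coord (cohomology_class g)) (repr (thead t))).
apply/funext => t; case/tupleP: t => x t; case/tupleP: t => y t.
rewrite (tuple0 t) /= (_ : [tuple of _] = [tuple x; y]); last exact/val_inj.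
rewrite cobord1E cochain_cup11E /thead !(tnth_nth 1%g) /=.
rewrite (cup_primitive_eq par (word_eq_repr _ _)) cup_primitive_cat.
by rewrite !raag_cocycle_val_repr; ring.
Qed.

End CupOnCoordinates.

(** * Bases of the first cohomology *)

Section H1Basis.
Variables (F : fieldType) (T : finType) (e : rel T).
Local Notation V := (cohomology F (raag e) 1).

Lemma dim_raag_H1 : \dim {:V} = #|T|.
Proof. by rewrite dimvf. Qed.

HB.instance Definition _ := GRing.isLinear.Build F V 'rV[F]_#|T| *:%R
  (@raag_coord F T e) (@raag_coord_linear F T e).

Definition coord_matrix n (w : n.-tuple V) : 'M[F]_(n, #|T|) :=
  \matrix_(i, j) raag_coord (tnth w i) ord0 j.

Lemma mul_coord_matrix n (w : n.-tuple V) (k : 'rV[F]_n) :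
  k *m coord_matrix w = raag_coord (\sum_i k ord0 i *: w`_i).
Proof.
apply/rowP => j; rewrite linear_sum summxE mxE; apply: eq_bigr => i _.
by rewrite linearZ !mxE (tnth_nth 0).
Qed.

Lemma free_coord_matrix n (w : n.-tuple V) : free w = row_free (coord_matrix w).
Proof.
have coord_inj := bij_inj (@raag_coord_bij F T e).
apply/freeP/idP => [fw|rf k kw].
  apply: inj_row_free => k; rewrite mul_coord_matrix => kw.
  apply/rowP => i; rewrite mxE; apply: (fw (k ord0)).
  by apply: coord_inj; rewrite kw linear0.
suff /rowP k0 : \row_i k i = 0 by move=> i; have := k0 i; rewrite !mxE.
apply: (row_free_inj rf); rewrite mul0mx mul_coord_matrix.
by under eq_bigr do rewrite mxE; rewrite kw linear0.
Qed.

Definition vertex_adj : rel 'I_#|T| := relpre enum_val e.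

Lemma cup_neq0E (a b : V) :
  (cup a b != 0) = edge_minor vertex_adj (raag_coord a) (raag_coord b).
Proof.
apply/idP/edge_minorP => [ab|[k [l [kl]]]]; last first.
  by apply: contra_neq => /cup_eq0P/(_ _ _ kl); rewrite !enum_valK.
apply: contra_neqP ab => noM; apply/cup_eq0P => x y xy.
apply/eqP/negPn/negP => min; apply: noM; exists (enum_rank x), (enum_rank y).
by rewrite /vertex_adj /= !enum_rankK.
Qed.

Definition dual_basis : #|T|.-tuple V :=
  [tuple cohomology_class (raag_cocycle e (delta_mx ord0 i)) | i < #|T|].

Lemma raag_coord_dual_basis i : raag_coord (tnth dual_basis i) = delta_mx ord0 i.
Proof. by rewrite tnth_mktuple raag_cocycleK. Qed.

Lemma dual_basisP : basis_of fullv dual_basis.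
Proof.
rewrite basisEfree subvf dim_raag_H1 size_tuple leqnn !andbT free_coord_matrix.
suff -> : coord_matrix dual_basis = 1%:M by rewrite row_free_unit unitmx1.
by apply/matrixP => i j; rewrite mxE raag_coord_dual_basis !mxE eqxx eq_sym.
Qed.

Lemma cup_dual_basis_edge (e_sym : symmetric e) i j :
  cup (tnth dual_basis i) (tnth dual_basis j) != 0 ->
  e (enum_val i) (enum_val j).
Proof.
rewrite cup_neq0E !raag_coord_dual_basis => /edge_minorP[k [l [kl]]].
rewrite !mxE /= -!natrM !mulnb.
have [/andP[/eqP<- /eqP<-] //|_] := boolP ((k == i) && (l == j)).
have [/andP[/eqP<- /eqP<-]|_] := boolP ((l == i) && (k == j)).
  by rewrite e_sym.
by rewrite eqxx.
Qed.

End H1Basis.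

(** * Hamiltonian paths as permutations *)

Section HamiltonianPaths.
Variables (T : finType) (e : rel T).

(** The orderings in the definition of a Hamiltonian pairing are permutations
    of the indices; this puts paths in the same form, by the enumeration of the
    vertices. *)
Lemma hamiltonian_path_perm :
  has_hamiltonian_path e <-> exists s : 'S_#|T|,
    forall i j : 'I_#|T|, j = i.+1 :> nat -> e (enum_val (s i)) (enum_val (s j)).
Proof.
split=> [[p [sorted_p uniq_p all_p]]|[s sP]].
  have size_p : size p == #|T|.
    by rewrite -(card_uniqP uniq_p); apply/eqP/eq_card => v; rewrite all_p.
  pose pt := Tuple size_p; have inj_pt : injective (enum_rank \o tnth pt).
    by apply: inj_comp; [exact: enum_rank_inj | exact/tuple_uniqP].
  exists (perm inj_pt) => i j ji; rewrite !permE /= !enum_rankK.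
  have x0 := tnth pt i; rewrite !(tnth_nth x0) /= ji.
  by move/(sortedP x0): sorted_p; apply; rewrite (eqP size_p) -ji.
pose p := [tuple enum_val (s i) | i < #|T|].
have nth_p x0 (i : 'I_#|T|) : nth x0 p i = enum_val (s i).
  by rewrite -tnth_nth tnth_mktuple.
exists p; split=> [||v].
- case def_p: (tval p) => [//|x0 q]; rewrite -def_p.
  apply/(sortedP x0) => i; rewrite size_tuple => lt_i.
  by rewrite (nth_p x0 (Ordinal (ltnW lt_i))) (nth_p x0 (Ordinal lt_i)) sP.
- by apply/tuple_uniqP => i j; rewrite !tnth_mktuple => /enum_val_inj/perm_inj.
- apply/tnthP; exists (s^-1%g (enum_rank v)).
  by rewrite tnth_mktuple permKV enum_rankK.
Qed.

End HamiltonianPaths.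

Unset Implicit Arguments.

Theorem theorem1p2 (T : finType) (e : rel T)
    (e_sym : symmetric e) (e_irr : irreflexive e) (F : fieldType) :
  has_hamiltonian_path e <-> hamiltonian (raag_cup F e).
Proof.
rewrite hamiltonian_path_perm; split=> [[s sP] n w w_basis|ham]; last first.
  have [s sP] := ham _ _ (dual_basisP F e).
  by exists s => i j ij; apply: (cup_dual_basis_edge e_sym); apply: sP.
have dim_n : #|T| = n by rewrite -(dim_raag_H1 F e) -(size_basis w_basis).
case: n / dim_n w w_basis => w /basis_free free_w.
have det_w : \det (coord_matrix w) != 0.
  by rewrite -unitfE -unitmxE -row_free_unit -free_coord_matrix.
have adj_sym : symmetric (vertex_adj e) by move=> i j; apply: e_sym.
have adj_irr : irreflexive (vertex_adj e) by move=> i; apply: e_irr.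
have [t tP] := spanning_edge_minors adj_sym adj_irr det_w.
have row_w i : row i (coord_matrix w) = raag_coord (tnth w i).
  by apply/rowP => j; rewrite !mxE.
exists (s * t)%g => i j ij; rewrite !permM.
have -> : raag_cup F e (tnth w (t (s i))) (tnth w (t (s j))) =
  cup (tnth w (t (s i))) (tnth w (t (s j))) by [].
by rewrite cup_neq0E -!row_w; apply/tP/sP.
Qed.
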